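(* Let $N\ge 2$ be an integer. If $M$ is an integer with $M \geq R_{N-1}-2N+1$, then for all integers $m \geq M$ with $m\ge 3$ and all integers $n$ with $3\le n \leq N$, $$\mathfrak{pr}(C_m+C_n) = \begin{cases} m+2n & \text{if } m \text{ is odd},\\ m+2n-1 & \text{if } m \text{ is even}.\end{cases}$$
   Context: All graphs are finite and simple. A coprime labeling of a graph $G$ is an injection $f\colon V(G)\to\{1,2,\dots,k\}$, for some integer $k\ge |V(G)|$, such that $\gcd(f(u),f(v))=1$ whenever $(u,v)\in E(G)$. The minimum coprime number $\mathfrak{pr}(G)$ is the least $k$ for which such a labeling exists. $C_n$ is the cycle on $n\ge 3$ vertices. The join $G+H$ of two disjoint graphs is the union $G\cup H$ together with all edges between a vertex of $G$ and a vertex of $H$. For $k\ge 1$, the $k$-th Ramanujan prime $R_k$ is the least integer such that $\pi(x)-\pi(x/2)\ge k$ for all $x\ge R_k$, where $\pi(x)$ is the number of primes less than or equal to $x$. *)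

(* Defs.v *)
From HB Require Import structures.
From mathcomp Require Import all_boot all_order all_algebra.
From mathcomp Require Import boolp reals.

Set Implicit Arguments.
Unset Strict Implicit.
Unset Printing Implicit Defensive.

Import Order.TTheory GRing.Theory Num.Theory.

Record sgraph := SGraph {
  vertex :> finType;
  edge : rel vertex;
  edge_sym : symmetric edge;
  edge_irrefl : irreflexive edge }.

(** [ordS i] is [i + 1] modulo [n]. The condition [i != j] only matters for
    [n = 1], where it removes the loop; it is redundant for [n >= 3]. *)
Definition cycle_edge (n : nat) : rel 'I_n :=
  fun i j => (i != j) && ((j == ordS i) || (i == ordS j)).

Lemma cycle_edge_sym n : symmetric (@cycle_edge n).
Proof. by move=> i j; rewrite /cycle_edge eq_sym orbC. Qed.

Lemma cycle_edge_irrefl n : irreflexive (@cycle_edge n).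
Proof. by move=> i; rewrite /cycle_edge eqxx. Qed.

Definition cycle_graph (n : nat) : sgraph :=
  SGraph (@cycle_edge_sym n) (@cycle_edge_irrefl n).

Definition join_edge (G H : sgraph) : rel (G + H)%type := fun x y =>
  match x, y with
  | inl u, inl v => edge u v
  | inr u, inr v => edge u v
  | _, _ => true
  end.

Lemma join_edge_sym G H : symmetric (@join_edge G H).
Proof. by move=> [u|u] [v|v] //=; rewrite edge_sym. Qed.

Lemma join_edge_irrefl G H : irreflexive (@join_edge G H).
Proof. by move=> [u|u] /=; rewrite edge_irrefl. Qed.

Definition join_graph (G H : sgraph) : sgraph :=
  SGraph (@join_edge_sym G H) (@join_edge_irrefl G H).

Definition coprime_labeling (G : sgraph) (k : nat) (f : G -> nat) : Prop :=
  [/\ injective f,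
      forall v, 1 <= f v <= k
    & forall u v, edge u v -> coprime (f u) (f v)].

Definition coprime_labelable (G : sgraph) (k : nat) : Prop :=
  #|G| <= k /\ exists f : G -> nat, coprime_labeling k f.

Lemma coprime_labelable_ex (G : sgraph) : exists k, `[< coprime_labelable G k >].
Proof.
pose P := fix P i := if i is j.+1 then s2val (prime_above (P j))
                     else s2val (prime_above 0).
have P_prime i : prime (P i) by case: i => [|i] /=; case: prime_above.
have P_lt : {homo P : i j / i < j}.
  by apply: (homo_ltn ltn_trans) => i /=; case: prime_above.
have P_inj : injective P by apply/incn_inj/leq_mono.
exists (#|G| + P #|G|); apply/asboolP; split; first exact: leq_addr.
exists (fun v => P (enum_rank v)); split.
- by move=> u v /P_inj/val_inj/enum_rank_inj.
- move=> v; rewrite prime_gt0 //= (leq_trans _ (leq_addl _ _)) //.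
  exact/ltnW/P_lt.
- move=> u v uv; rewrite prime_coprime // dvdn_prime2 //.
  apply: contraTneq uv => /P_inj/val_inj/enum_rank_inj ->.
  by rewrite edge_irrefl.
Qed.

Definition min_coprime_number (G : sgraph) : nat :=
  ex_minn (coprime_labelable_ex G).

(** [Num.truncn x] is the integer part of [x] if [0 <= x], and [0] otherwise. *)
Definition prime_pi (R : realType) (x : R) : nat :=
  count prime (iota 0 (Num.truncn x).+1).

Local Open Scope ring_scope.

Definition ramanujan_bound (R : realType) (k : nat) (r : int) : Prop :=
  forall x : R, r%:~R <= x -> (k <= prime_pi x - prime_pi (x / 2))%N.

Definition is_ramanujan_prime (R : realType) (k : nat) (r : int) : Prop :=
  ramanujan_bound R k r /\ forall s : int, ramanujan_bound R k s -> r <= s.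

(* Main.v *)
Require Import Defs.
From HB Require Import structures.
From mathcomp Require Import all_boot all_order all_algebra.
From mathcomp Require Import boolp reals.
From mathcomp Require Import zify.

Set Implicit Arguments.
Unset Strict Implicit.
Unset Printing Implicit Defensive.

Import Order.TTheory GRing.Theory Num.Theory.

(** The even labels of a coprime labeling form an independent set of the join,
so they all lie on one of the two cycles and occupy at most half of it; the
other vertices carry distinct odd labels. If the longer cycle [C_m] takes the
evens, at least [n + uphalf m] odd labels are needed, and the last of them is at
least [m + 2n] or [m + 2n - 1] according to the parity of [m]; if [C_n] takes
them, no fewer odd labels are needed, because [n <= m]. This is
[join_cycles_label_bound].

Conversely let [k] be the claimed value, which is odd. Suppose that [n - 1]
primes lie in [(k/2, k]]. Each of them is coprime to all other labels up to [k],
so these primes and [1] can be placed on [C_n] without constraining anything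
else. All remaining odd numbers go on [C_m]: in increasing order, with an even
number coprime to both neighbours inserted between two consecutive ones. Such an
even number exists because the gaps left by the removed primes are at most [6]:
among three consecutive odd numbers one is a multiple of [3]
([coprime_path_avoiding]). The label [2], coprime to every odd number, closes the
cycle; for odd [m] the even number between [3] and [5] is left out.

It remains to find the primes. By hypothesis
[k + 2 (N - n) >= m + 2N - 1 >= R_(N-1)],
and an interval of length [2 (N - n)] beyond [2] holds at most [N - n] primes, so
[pi(k) - pi(k/2)] is at least [N - 1 - (N - n) = n - 1]
([primes_in_upper_half]). The inequality [n <= m] and the smallest cases rest on
the lower bounds [R_(N-1) >= 11], [R_(N-1) >= 17] for [N >= 4], and
[R_(N-1) >= 4N - 7]. *)

(** * Counting primes in intervals *)

Definition pi_nat (x : nat) : nat := count prime (iota 0 x.+1).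

Lemma pi_natS x : pi_nat x.+1 = pi_nat x + prime x.+1.
Proof. by rewrite /pi_nat -[in LHS](addn1 x.+1) iotaD count_cat /= addn0. Qed.

(** Beyond [2] every other integer is even, hence composite, so two consecutive
integers add at most one prime. *)
Lemma pi_nat_interval a d : 2 <= a -> 2 * pi_nat (a + d) <= 2 * pi_nat a + d.+1.
Proof.
move=> a2; elim/ltn_ind: d => -[_|[_|d IH]].
- by rewrite addn0; lia.
- by rewrite addn1 pi_natS; case: prime; lia.
have := IH d (ltnW (ltnSn _)); rewrite !addnS !pi_natS.
have even_composite x : 2 < x -> ~~ odd x -> prime x = false.
  by move=> x2; apply: contraNF => /even_prime[]; lia.
have [odd_ad|even_ad] := boolP (odd (a + d)).
  by rewrite (@even_composite (a + d).+1) ?oddS ?odd_ad //; lia.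
by rewrite (@even_composite (a + d).+2) ?oddS ?negbK //; lia.
Qed.

Lemma pi_nat_le x y : x <= y -> pi_nat x <= pi_nat y.
Proof. by move=> /subnK <-; elim: (y - x) => // d; rewrite addSn pi_natS; lia. Qed.

Lemma count_primes_half k :
  size [seq p <- iota k./2.+1 (k - k./2) | prime p] = pi_nat k - pi_nat k./2.
Proof.
rewrite size_filter /pi_nat; have -> : k.+1 = k./2.+1 + (k - k./2) by lia.
by rewrite iotaD count_cat add0n addKn.
Qed.

(** * Ramanujan bounds on integers *)

Lemma prime_pi_nat (R : realType) (x : nat) : prime_pi (x%:R : R) = pi_nat x.
Proof. by rewrite /prime_pi natrK. Qed.

Lemma prime_pi_half (R : realType) (x : nat) :
  prime_pi (x%:R / 2 : R)%R = pi_nat x./2.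
Proof.
rewrite /prime_pi (@Num.Theory.truncn_def _ _ x./2) //.
rewrite ler_pdivlMr ?ltr0n // ltr_pdivrMr ?ltr0n // -!natrM ler_nat ltr_nat.
by lia.
Qed.

Lemma ramanujan_bound_nat (R : realType) k (r : int) (x : nat) :
  ramanujan_bound R k r -> (r <= x%:Z)%R -> k <= pi_nat x - pi_nat x./2.
Proof.
move=> /(_ x%:R%R) rb rx; rewrite -(prime_pi_nat R) -(prime_pi_half R).
by apply: rb; rewrite -[leRHS]/(x%:Z%:~R)%R ler_int.
Qed.

(** [pi 10 - pi 5 = 4 - 3 < 2]. *)
Lemma ramanujan_bound_gt10 (R : realType) k (r : int) :
  2 <= k -> ramanujan_bound R k r -> (11%:Z <= r)%R.
Proof.
move=> k2 rb; rewrite leNgt; apply/negP => r_lt.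
have := @ramanujan_bound_nat R k r 10 rb ltac:(lia).
by rewrite (_ : pi_nat 10 - pi_nat 10./2 = 1) //; lia.
Qed.

(** [pi 16 - pi 8 = 6 - 4 < 3]. *)
Lemma ramanujan_bound_gt16 (R : realType) k (r : int) :
  3 <= k -> ramanujan_bound R k r -> (17%:Z <= r)%R.
Proof.
move=> k3 rb; rewrite leNgt; apply/negP => r_lt.
have := @ramanujan_bound_nat R k r 16 rb ltac:(lia).
by rewrite (_ : pi_nat 16 - pi_nat 16./2 = 2) //; lia.
Qed.

(** There are [k] primes in [(r/2, r]]; they are odd, so this interval has length at least
about [2k]. *)
Lemma ramanujan_bound_linear (R : realType) k (r : int) :
  2 <= k -> ramanujan_bound R k r -> (4 * k%:Z - 3 <= r)%R.
Proof.
move=> k2 rb; have := ramanujan_bound_gt10 k2 rb; case: r rb => // r rb r10.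
have := @ramanujan_bound_nat R k r r rb ltac:(lia).
have := @pi_nat_interval r./2 (r - r./2) ltac:(lia).
by rewrite (_ : r./2 + (r - r./2) = r); lia.
Qed.

(** Going down from [r] to [x] loses at most one prime for every two integers,
while the primes up to [x/2] are no more numerous than those up to [r/2]. *)
Lemma primes_in_upper_half (R : realType) k (r : int) j (x : nat) :
  2 <= k -> ramanujan_bound R k r -> (r <= x%:Z + (2 * j)%:Z)%R ->
  2 <= x -> k - j <= pi_nat x - pi_nat x./2.
Proof.
move=> k2 rb rx x2; have := ramanujan_bound_gt10 k2 rb; case: r rb rx => // r rb rx _.
have [r_le|x_lt] := leqP r x.
  by have := @ramanujan_bound_nat R k r x rb ltac:(lia); lia.
have := @ramanujan_bound_nat R k r r rb ltac:(lia).
have := @pi_nat_interval x (r - x) x2; rewrite subnKC; last by lia.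
have : pi_nat x./2 <= pi_nat r./2 by apply: pi_nat_le; lia.
lia.
Qed.

(** * Cycles of coprime numbers avoiding given primes *)

(** Requiring the labels to increase along a path makes them distinct. *)
Definition coprime_above : rel nat := fun x y => (x < y) && coprime x y.

(** The candidates are [a + 1] and [a + q]. The first is adjacent to [a] and at
distance [q] from the other end, the second the other way round, so they can
only fail if [q] divides [a + 1], respectively [a]; not both occur. *)
Lemma coprime_between a q :
  prime q -> odd q -> odd a ->
  exists e, [/\ ~~ odd e, coprime_above a e & coprime_above e (a + q.+1)].
Proof.
move=> q_pr q_odd a_odd; have q0 := prime_gt0 q_pr.
have [q_a|q_a] := boolP (q %| a).
  exists a.+1; rewrite /coprime_above coprimenS (_ : a + q.+1 = a.+1 + q); last by lia.
  rewrite /coprime gcdnDl -/(coprime _ _) coprime_sym prime_coprime // -addn1.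
  rewrite dvdn_addr // dvdn1 (gtn_eqF (prime_gt1 q_pr)); split; lia.
exists (a + q); rewrite /coprime_above addnS coprimenS.
rewrite /coprime gcdnDl -/(coprime _ _) coprime_sym prime_coprime // q_a.
by split; lia.
Qed.

(** The path visits every odd number of [[a, a + 2 t]] outside [Q]. Its last
vertex [a + 2 j] is the largest of these, and the conclusion on the indices
beyond [j] is what lets the induction bound the next gap: three
consecutive odd numbers are never all in [Q], so the gap is [2], [4] or [6], and
for the last two [coprime_between] applies with [q = 3] and [q = 5]. *)
Lemma coprime_path_avoiding (Q : pred nat) a t :
  odd a -> (forall x, Q x -> odd x) ->
  (forall c, a < c -> odd c -> ~~ [&& Q c, Q (c + 2) & Q (c + 4)]) ->
  exists s j, [/\ path coprime_above a s, all (predC Q) s,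
    size s = 2 * count (fun i => ~~ Q (a + 2 * i)) (iota 1 t),
    last a s = a + 2 * j & j <= t /\ forall i, j < i <= t -> Q (a + 2 * i)].
Proof.
move=> a_odd Q_odd Q_gap; elim: t => [|t [s [j [s_path sQ s_size s_last [jt jQ]]]]].
  by exists [::], 0; split=> //=; [lia | split=> // i; lia].
have sizeE : count (fun i => ~~ Q (a + 2 * i)) (iota 1 t.+1) =
    count (fun i => ~~ Q (a + 2 * i)) (iota 1 t) + ~~ Q (a + 2 * t.+1).
  by rewrite -[in LHS](addn1 t) iotaD count_cat /= addn0 add1n.
have [Qt|notQt] := boolP (Q (a + 2 * t.+1)).
  exists s, j; split=> //; [by rewrite s_size sizeE Qt; lia | split=> [|i]; first by lia].
  by case: (i =P t.+1) => [-> //|i_neq i_range]; apply: jQ; lia.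
have j_close : t - j <= 2.
  rewrite leqNgt; apply/negP => far.
  have := Q_gap (a + 2 * j.+1) ltac:(lia) ltac:(lia).
  rewrite (_ : a + 2 * j.+1 + 2 = a + 2 * j.+2); last by lia.
  rewrite (_ : a + 2 * j.+1 + 4 = a + 2 * j.+3); last by lia.
  by rewrite !jQ //; lia.
have [e [e_even je et]] : exists e, [/\ ~~ odd e, coprime_above (a + 2 * j) e &
    coprime_above e (a + 2 * t.+1)].
  have odd_j : odd (a + 2 * j) by lia.
  have [->|[->|->]] : t = j \/ t = j.+1 \/ t = j.+2 by lia.
  - exists (a + 2 * j).+1; have -> : a + 2 * j.+1 = (a + 2 * j).+2 by lia.
    by rewrite /coprime_above !coprimenS !ltnSn /= odd_j.
  - rewrite (_ : a + 2 * j.+2 = a + 2 * j + 3.+1); last by lia.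
    exact: coprime_between.
  rewrite (_ : a + 2 * j.+3 = a + 2 * j + 5.+1); last by lia.
  exact: coprime_between.
exists (s ++ [:: e; a + 2 * t.+1]), t.+1; split=> //; last by split=> // i; lia.
- by rewrite cat_path s_path s_last /= je et.
- rewrite all_cat sQ /= notQt andbT /=.
  by rewrite andbT; apply: contraNN e_even; apply: Q_odd.
- by rewrite size_cat s_size sizeE notQt /=; lia.
- by rewrite last_cat.
Qed.

(** * Labelings of the join of two cycles *)

Lemma cycle_nth_ordS (e : rel nat) x0 m (A : seq nat) (i : 'I_m) :
  size A = m -> cycle e A -> e (nth x0 A i) (nth x0 A (ordS i)).
Proof.
move=> sA; subst m; case: A i => [[] //|x p] i.
rewrite /cycle => /(pathP x0); rewrite size_rcons => /(_ i (ltn_ord i)).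
rewrite -rcons_cons !nth_rcons ltn_ord /=.
have [i_lt|i_ge] := ltnP i (size p); first by rewrite modn_small // ltnS.
have -> : i = size p :> nat by apply/eqP; rewrite eqn_leq i_ge -ltnS ltn_ord.
by rewrite eqxx modnn.
Qed.

(** The labels of the second cycle are asked to be coprime to every other label,
whatever the edges; only the order of [A] matters. *)
Lemma join_cycles_labelable m n k (A B : seq nat) :
  size A = m -> size B = n ->
  cycle coprime A -> {in B &, forall x y, x != y -> coprime x y} ->
  {in A & B, forall x y, coprime x y} ->
  uniq (A ++ B) -> all (fun x => 1 <= x <= k) (A ++ B) ->
  coprime_labelable (join_graph (cycle_graph m) (cycle_graph n)) k.
Proof.
move=> sA sB cycA coB coAB uAB /allP rAB.
have memA (i : 'I_m) : nth 0 A i \in A by rewrite mem_nth // sA.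
have memB (i : 'I_n) : nth 0 B i \in B by rewrite mem_nth // sB.
have [uA disjAB uB] := and3P (etrans (esym (cat_uniq _ _)) uAB).
have disj x : x \in A -> x \in B -> False.
  by move=> xA xB; move/hasPn: disjAB => /(_ _ xB) /negP; apply.
split.
  rewrite card_sum !card_ord -sA -sB -size_cat -(size_iota 1 k).
  by apply: uniq_leq_size => // x /rAB; rewrite mem_iota add1n ltnS.
exists (fun v : 'I_m + 'I_n =>
  match v with inl i => nth 0 A i | inr j => nth 0 B j end).
split.
- move=> [i|i] [j|j] /= eq_ij.
  + by congr inl; apply/ord_inj/eqP; rewrite -(nth_uniq 0 _ _ uA) ?sA ?eq_ij.
  + by case: (disj _ (memA i)); rewrite eq_ij.
  + by case: (disj _ (memA j)); rewrite -eq_ij.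
  + by congr inr; apply/ord_inj/eqP; rewrite -(nth_uniq 0 _ _ uB) ?sB ?eq_ij.
- by case=> i; apply: rAB; rewrite mem_cat ?memA ?memB ?orbT.
- move=> [i|i] [j|j] //=.
  + case/andP=> _ /orP[] /eqP->; last rewrite coprime_sym; exact: cycle_nth_ordS.
  + by move=> _; apply: coAB.
  + by move=> _; rewrite coprime_sym; apply: coAB.
  + case/andP=> ij _; apply: coB => //; rewrite nth_uniq ?sB //.
Qed.

(** The only multiple of [p] in [[1, k]] is [p] itself. *)
Lemma coprime_upper_half_prime p x k :
  prime p -> k < 2 * p -> 0 < x <= k -> x != p -> coprime x p.
Proof.
move=> p_pr p_gt x_range; rewrite coprime_sym prime_coprime //.
apply: contraNN => /dvdnP[[|[|c]] x_eq]; first by rewrite x_eq in x_range.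
  by rewrite x_eq mul1n.
have : 2 * p <= x by rewrite x_eq leq_mul2r orbT.
lia.
Qed.

(** The cycle runs through [2], [3], [4] and then the increasing path from [5];
the last label is odd, so [2] closes it. Since [3] and [5] are coprime, [4] may be
dropped, which is how both parities of the length are reached: the boolean [b]
says that it is dropped. *)
Lemma coprime_cycle_avoiding (ps : seq nat) k (b : bool) :
  uniq ps -> {in ps, forall p, prime p && (5 < p <= k)} -> 5 <= k -> odd k ->
  exists A, [/\ uniq A, cycle coprime A, size A = k - 1 - b - 2 * size ps,
    {in A, forall x, 2 <= x <= k} & {in A, forall x, x \notin ps}].
Proof.
move=> ups psP k5 k_odd.
have ps_odd p : p \in ps -> odd p.
  by move/psP => /andP[/even_prime[->|->]].
have [||s [j [s_path sQ s_size s_last [jt _]]]] :=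
    @coprime_path_avoiding (mem ps) 5 (k - 5)./2 isT.
- by move=> x /ps_odd.
- move=> c c5 c_odd; apply/and3P => -[/psP/andP[c0 _] /psP/andP[c2 _] /psP/andP[c4 _]].
  have prime3 p : prime p -> 3 %| p -> p = 3.
    by move=> p_pr /=; rewrite dvdn_prime2 // => /eqP.
  (* Primes above 5 are not multiples of 3, but one of the three numbers is. *)
  have : [|| 3 %| c, 3 %| c + 2 | 3 %| c + 4] by clear -c5; lia.
  by case/or3P => /prime3; lia.
have count_ps : count (fun i => 5 + 2 * i \in ps) (iota 1 (k - 5)./2) = size ps.
  rewrite -(count_map (fun i => 5 + 2 * i) (mem ps)) -size_filter.
  apply/perm_size/uniq_perm => //.
    by rewrite filter_uniq // map_inj_uniq ?iota_uniq // => x y; lia.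
  move=> p; rewrite mem_filter -[mem ps p]/(p \in ps).
  have [p_ps|//] := boolP (p \in ps); rewrite /=.
  have /andP[_ p_range] := psP _ p_ps; have p_odd := ps_odd _ p_ps.
  apply/mapP; exists (p - 5)./2; rewrite ?mem_iota; clear -p_range p_odd k_odd; lia.
have {s_size count_ps} size_path : size s = 2 * ((k - 5)./2 - size ps) /\
    size ps <= (k - 5)./2.
  have := count_predC (fun i => 5 + 2 * i \in ps) (iota 1 (k - 5)./2).
  rewrite size_iota s_size count_ps => tot; split; last by rewrite -tot leq_addr.
  by rewrite -[X in _ = 2 * (X - _)]tot addKn.
have s_lt : path ltn 5 s by apply: sub_path s_path => x y /andP[].
have s_gt5 : {in s, forall x, 5 < x} := allP (order_path_min ltn_trans s_lt).
have us : uniq (5 :: s) := @sorted_uniq _ ltn ltn_trans ltnn (5 :: s) s_lt.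
have s_cop : path coprime 5 s by apply: sub_path s_path => x y /andP[].
have s_le : {in s, forall x, x <= k}.
  move=> x xs; apply: leq_trans (_ : last 5 s <= k).
    move: s_lt; case/splitPr: xs => s1 s2; rewrite last_cat cat_path /=.
    case/and3P=> _ _ /(order_path_min ltn_trans) /allP x_min.
    by have := mem_last x s2; rewrite inE => /orP[/eqP->|/x_min /ltnW].
  by clear -s_last jt k5; lia.
have last_odd : coprime (last 5 s) 2 by rewrite coprimen2 s_last oddD oddM.
pose A := if b then [:: 2, 3, 5 & s] else [:: 2, 3, 4, 5 & s].
have A_cases x : x \in A -> 2 <= x <= 5 \/ x \in s.
  by rewrite /A; case: (b); rewrite !inE; do ?[case/orP => [/eqP->|]]; auto.
exists A; split.
- have small x : x <= 5 -> x \notin s.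
    by move=> x5; apply/negP => /s_gt5; rewrite ltnNge x5.
  by move: us; rewrite /A; case: (b); rewrite /= !inE !negb_or !small.
- by rewrite /A; case: (b); rewrite /= rcons_path /= s_cop last_odd.
- by rewrite /A; clear -size_path k5 k_odd; case: b => /=; lia.
- move=> x /A_cases[/andP[-> x5]|xs]; first exact: leq_trans x5 k5.
  by rewrite s_le // andbT; apply: leq_trans (s_gt5 x xs).
- move=> x /A_cases[/andP[_ x5]|xs]; last by move/allP: sQ => /(_ _ xs).
  by apply/negP => /psP/and3P[_ + _]; rewrite ltnNge x5.
Qed.

(** The second cycle gets [1] and primes above [k/2]. The value of [k] is exactly
the one that leaves [uphalf m] odd numbers for the first cycle. *)
Lemma join_cycles_labelable_of_primes m n k :
  3 <= n -> 10 <= k -> k = (if odd m then m + 2 * n else m + 2 * n - 1) ->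
  n - 1 <= pi_nat k - pi_nat k./2 ->
  coprime_labelable (join_graph (cycle_graph m) (cycle_graph n)) k.
Proof.
move=> n3 k10 k_eq; rewrite -count_primes_half => enough.
pose ps := take (n - 1) [seq p <- iota k./2.+1 (k - k./2) | prime p].
have sps : size ps = n - 1 by rewrite size_takel.
have ups : uniq ps by rewrite take_uniq // filter_uniq // iota_uniq.
have psP p : p \in ps -> [/\ prime p, k < 2 * p & p <= k].
  move/mem_take; rewrite mem_filter mem_iota => /andP[p_pr p_int].
  by split=> //; clear -p_int; lia.
have k_odd : odd k by clear -k_eq n3; move: k_eq; case: ifP; lia.
have [||A [uA cycA sA A_range A_ps]] := @coprime_cycle_avoiding ps k (odd m) ups _ _ k_odd.
- by move=> p /psP[-> p_gt p_le]; clear -p_gt p_le k10; lia.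
- exact: leq_trans k10.
apply: (@join_cycles_labelable m n k A (1 :: ps)) => //.
- by rewrite sA sps; clear -n3 k_eq; move: k_eq; case: (odd m); lia.
- by rewrite /= sps; clear -n3; lia.
- move=> x y; rewrite !inE => /orP[/eqP->|/psP[x_pr _ x_le]]; first by rewrite coprime1n.
  case/orP => [/eqP->|/psP[y_pr y_gt _] xy]; first by rewrite coprimen1.
  by apply: coprime_upper_half_prime y_gt _ xy; rewrite ?prime_gt0.
- move=> x y xA; rewrite inE => /orP[/eqP->|yps]; first by rewrite coprimen1.
  have [y_pr y_gt _] := psP _ yps; have /andP[x2 x_le] := A_range _ xA.
  apply: coprime_upper_half_prime y_gt _ _ => //; first by rewrite x_le ltnW.
  by apply: contraNneq (A_ps _ xA) => ->.
- rewrite cat_uniq uA /= ups andbT negb_or; apply/andP; split.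
    apply/andP; split; first by apply/negP => /A_range.
    by apply/hasPn => x xps; apply/negP => /A_ps; rewrite xps.
  by apply/negP => /psP[].
- apply/allP => x; rewrite mem_cat inE => /or3P[/A_range/andP[x2 ->]|/eqP->|].
  + by rewrite ltnW.
  + exact: leq_trans k10.
  by case/psP => x_pr _ ->; rewrite prime_gt0.
Qed.

(** * The lower bound *)

(** The successor map sends an independent set injectively into its
complement. *)
Lemma cycle_independent m (I : {pred 'I_m}) :
  2 <= m -> (forall i j : 'I_m, cycle_edge i j -> ~~ (I i && I j)) ->
  2 * #|I| <= m.
Proof.
move=> m2 indep; rewrite mul2n -addnn -[X in _ <= X]card_ord -(cardC I) leq_add2l.
rewrite -(card_imset I (@ordS_inj m)); apply/subset_leq_card/subsetP => j.
case/imsetP => i Ii ->; rewrite !inE.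
have := indep i (ordS i); rewrite /cycle_edge eqxx /= andbT.
have -> : i != ordS i.
  rewrite -val_eqE /=; case: (ltngtP i.+1 m) (ltn_ord i) => // [lt _|im _].
    by rewrite modn_small //; lia.
  by rewrite im modnn; lia.
by move=> /(_ isT); rewrite -[I i]/(i \in I) Ii.
Qed.

Lemma card_odd_labels (T : finType) (f : T -> nat) k :
  injective f -> (forall v, f v <= k) ->
  2 * #|[pred v | odd (f v)]| <= k.+1.
Proof.
move=> f_inj f_le; suff : #|[pred v | odd (f v)]| <= #|'I_(k.+1)./2|.
  by rewrite card_ord; lia.
case: k f_le => [|k] f_le.
  by rewrite eq_card0 // => v; rewrite inE; have := f_le v; case: (f v).
apply: (@leq_card_in _ _ (fun v => inord (f v)./2 : 'I_(k./2).+1)) => u v.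
rewrite !inE => u_odd v_odd /(congr1 val) /=.
rewrite !inordK; first by move=> ?; apply: f_inj; lia.
  by have := f_le v; lia.
by have := f_le u; lia.
Qed.

Lemma coprime_evens x y : ~~ odd x -> ~~ odd y -> coprime x y = false.
Proof.
rewrite -!dvdn2 => x2 y2; apply/negP => /eqP gcd1.
by have : 2 %| gcdn x y; [rewrite dvdn_gcd x2 | rewrite gcd1].
Qed.

(** Two even labels on different cycles would be adjacent, so one cycle has only
odd labels and the other has at least half of its labels odd; the condition
[n <= m] makes it cheapest to have the even labels on the first cycle. *)
Lemma join_cycles_label_bound m n k :
  3 <= n <= m ->
  coprime_labelable (join_graph (cycle_graph m) (cycle_graph n)) k ->
  (if odd m then m + 2 * n else m + 2 * n - 1) <= k.
Proof.
move=> n_range [_ [f [f_inj f_range f_cop]]].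
have f_le v : f v <= k by case/andP: (f_range v).
pose odd_l := [pred i : 'I_m | odd (f (inl i))].
pose odd_r := [pred j : 'I_n | odd (f (inr j))].
have odd_le : 2 * (#|odd_l| + #|odd_r|) <= k.+1.
  rewrite (_ : #|odd_l| + #|odd_r| = #|[pred v | odd (f v)]|).
    exact: card_odd_labels.
  by rewrite -!sum1_card big_sumType /=; congr (_ + _); apply: eq_bigl => i; rewrite !inE.
have even_l : 2 * #|predC odd_l| <= m.
  apply: cycle_independent => [|i j ij]; first by lia.
  by apply/negP => /andP[/= ? ?]; have := f_cop (inl i) (inl j) ij;
    rewrite coprime_evens.
have even_r : 2 * #|predC odd_r| <= n.
  apply: cycle_independent => [|i j ij]; first by lia.
  by apply/negP => /andP[/= ? ?]; have := f_cop (inr i) (inr j) ij;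
    rewrite coprime_evens.
have one_side : #|predC odd_l| = 0 \/ #|predC odd_r| = 0.
  have [|/card_gt0P[i i_even]] := posnP #|predC odd_l|; first by left.
  right; apply: eq_card0 => j; apply/negP; rewrite !inE in i_even * => /negP j_even.
  by have := f_cop (inl i) (inr j) isT; rewrite coprime_evens.
have := cardC odd_l; have := cardC odd_r; rewrite !card_ord.
move: #|odd_l| #|predC odd_l| #|odd_r| #|predC odd_r| n_range
  odd_le even_l even_r one_side; clear.
move=> ol el orr er /andP[n3 nm] odd_le even_l even_r one_side sum_r sum_l.
by case: ifP; lia.
Qed.

Local Open Scope ring_scope.

Theorem theorem4p4 (R : realType) (N : nat) (RN1 M : int) :
  (2 <= N)%N ->
  is_ramanujan_prime R (N - 1)%N RN1 ->
  RN1 - 2 * N%:Z + 1 <= M ->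
  forall m n : nat,
    M <= m%:Z -> (3 <= m)%N -> (3 <= n <= N)%N ->
    min_coprime_number (join_graph (cycle_graph m) (cycle_graph n)) =
      (if odd m then m + 2 * n else m + 2 * n - 1)%N.
Proof.
move=> _ [rb _] M_ge m n mM m3 /andP[n3 nN].
have N1 : (2 <= N - 1)%N by lia.
have r11 := ramanujan_bound_gt10 N1 rb.
have r17 : (4 <= N)%N -> 17%:Z <= RN1.
  by move=> N4; apply: ramanujan_bound_gt16 rb; lia.
have r_lin := ramanujan_bound_linear N1 rb.
(* From M >= RN1 - 2N + 1: m >= 11 - 5 for N = 3, m >= 17 - 9 for N at most 5,
   and m >= (4N - 7) - 2N + 1 = 2N - 6 >= N beyond. *)
have [mN m6] : (N <= m)%N /\ (6 <= m)%N.
  by have [N4|N3] := leqP 4 N; [have := r17 N4 | ]; lia.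
set k := (if odd m then _ else _)%N.
have k_ge : (m + 2 * n - 1 <= k)%N by rewrite /k; case: ifP; lia.
apply/eqP; rewrite eqn_leq /min_coprime_number; case: ex_minnP => l /asboolP l_ok l_min.
apply/andP; split.
  apply: l_min; apply/asboolP; apply: join_cycles_labelable_of_primes => //; first by lia.
  (* RN1 <= m + 2N - 1 <= k + 2 (N - n), as k >= m + 2n - 1. *)
  have := @primes_in_upper_half R _ _ (N - n) k N1 rb ltac:(lia) ltac:(lia).
  by lia.
by apply: join_cycles_label_bound l_ok; lia.
Qed.
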